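(* Let $X$ be a finite set with $|X|\ge 2$. If $G\le\mathrm{Aut}(X^* )$ is a torsion-free bounded automata group, then there is a torsion-free generalized basilica group $H$ and $k\ge 1$ such that $H$ is isomorphic to a subgroup of $G$ and there is an injective homomorphism \[ G\hookrightarrow \mathrm{Sym}(X^k)\ltimes H^{X^k}. \]
   Context: For a finite set $X$ with $|X|\ge 2$, $X^*$ is the free monoid on $X$, viewed as a rooted tree (its Cayley graph), and $X^k$ is the set of words of length $k$. $\mathrm{Aut}(X^* )$ is the group of bijections $g$ of $X^*$ such that $a$ is a prefix of $b$ if and only if $g(a)$ is a prefix of $g(b)$. For $g\in\mathrm{Aut}(X^* )$ and $w\in X^*$, the section $g_w\in \mathrm{Aut}(X^* )$ is the automorphism determined by $g(wu)=g(w)g_w(u)$ for all $u\in X^*$. A group $G\le \mathrm{Aut}(X^* )$ is self-similar if $g_w\in G$ for all $g\in G$, $w\in X^*$. An element $g$ is finite state if $\{g_v\mid v\in X^*\}$ is finite, and bounded if there is $N\ge 0$ such that $|\{v\in X^n\mid g_v\ne 1\}|\le N$ for all $n\ge 1$. $G\le\mathrm{Aut}(X^* )$ is a bounded automata group if it is finitely generated, self-similar, and every element of $G$ is bounded and finite state. A generalized basilica group is a group $H\le\mathrm{Aut}(O^* )$, for some finite set $O$ with $|O|\geq 2$ (not necessarily equal to $X$), admitting a finite generating set $Y$ such that for every $g\in Y$ either $g_x=1$ for all $x\in O$, or $g_x\in\{1,g\}$ for all $x\in O$ with exactly one $x\in O$ such that $g_x=g$. In $\mathrm{Sym}(X^k)\ltimes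 H^{X^k}$ the group $\mathrm{Sym}(X^k)$ acts by permuting coordinates. *)

(* Defs.v *)
From HB Require Import structures.
From mathcomp Require Import all_boot all_fingroup.
From mathcomp Require Import boolp classical_sets functions cardinality.

Set Implicit Arguments.
Unset Strict Implicit.
Unset Printing Implicit Defensive.

Local Open Scope group_scope.

(* Subgroups of a [groupType], possibly infinite, are the [groupClosed]
   predicates; [subgroup G] is the group of the elements of [G]. *)
Section Subgroup.
Variables (gT : groupType) (G : groupClosed gT).

Definition subgroup := {x : gT | x \in G}.

HB.instance Definition _ := SubChoice.on subgroup.

Fact subgroup_closed : group_closed [pred x : gT | x \in G].
Proof. by split=> [|x y]; rewrite ?inE; [exact: gpred1 | exact: gpredF]. Qed.

HB.instance Definition _ :=
  SubChoice_isSubGroup.Build gT _ subgroup subgroup_closed.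

End Subgroup.

Definition torsion_free (gT : groupType) : Prop :=
  forall (x : gT) (n : nat), (0 < n)%N -> x ^+ n = 1 -> x = 1.

Definition generates (gT : groupType) (Y : set gT) (G : groupClosed gT) : Prop :=
  (Y `<=` [set` G])%classic /\
  forall K : groupClosed gT, (Y `<=` [set` K])%classic -> {subset G <= K}.

Definition finitely_generated (gT : groupType) (G : groupClosed gT) : Prop :=
  exists Y : set gT, finite_set Y /\ generates Y G.

Definition isomorphic (gT hT : groupType) : Prop :=
  exists f : {multiplicative gT -> hT}, bijective f.

Definition isomorphic_to_subgroup (hT gT : groupType) (G : groupClosed gT) : Prop :=
  exists K : groupClosed gT, {subset K <= G} /\ isomorphic hT (subgroup K).

Section Wreath.
Variables (I : finType) (H : groupType).

Record wreath := Wreath { wperm : {perm I}; wfun : {ffun I -> H} }.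

Definition wreath_pair (u : wreath) := (wperm u, wfun u).
Definition pair_wreath (p : {perm I} * {ffun I -> H}) := Wreath p.1 p.2.
Fact wreath_pairK : cancel wreath_pair pair_wreath.
Proof. by case. Qed.

HB.instance Definition _ := Choice.copy wreath (can_type wreath_pairK).

(* The product of [Sym I] is composition, [s t = s \o t], so that it acts on
   the left of [I], and on the right of [H^I] by [f^s = f \o s].  As the
   product of [{perm I}] is composition in the reverse order, it is swapped. *)
Definition wreath_one := Wreath 1 [ffun=> 1].
Definition wreath_mul (u v : wreath) :=
  Wreath (wperm v * wperm u) [ffun i => wfun u (wperm v i) * wfun v i].
Definition wreath_inv (u : wreath) :=
  Wreath (wperm u)^-1 [ffun i => (wfun u ((wperm u)^-1 i))^-1].

Fact wreath_mulA : associative wreath_mul.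
Proof.
move=> u v w; congr Wreath; first by rewrite /= mulgA.
by apply/ffunP=> i; rewrite !ffunE permM mulgA.
Qed.

Fact wreath_mul1g : left_id wreath_one wreath_mul.
Proof.
case=> s f; congr Wreath; first by rewrite /= mulg1.
by apply/ffunP=> i; rewrite !ffunE mul1g.
Qed.

Fact wreath_mulg1 : right_id wreath_one wreath_mul.
Proof.
case=> s f; congr Wreath; first by rewrite /= mul1g.
by apply/ffunP=> i; rewrite !ffunE perm1 mulg1.
Qed.

Fact wreath_mulVg : left_inverse wreath_one wreath_inv wreath_mul.
Proof.
case=> s f; congr Wreath; first by rewrite /= mulgV.
by apply/ffunP=> i; rewrite !ffunE permK mulVg.
Qed.

Fact wreath_mulgV : right_inverse wreath_one wreath_inv wreath_mul.
Proof.
case=> s f; congr Wreath; first by rewrite /= mulVg.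
by apply/ffunP=> i; rewrite !ffunE mulgV.
Qed.

HB.instance Definition _ := isGroup.Build wreath
  wreath_mulA wreath_mul1g wreath_mulg1 wreath_mulVg wreath_mulgV.

End Wreath.

Section TreeAut.
Variable X : finType.

Record treeAut := TreeAut {
  tree_fun :> seq X -> seq X;
  treeAut_bij : bijective tree_fun;
  treeAut_prefix : {mono tree_fun : a b / prefix a b} }.

Lemma treeAutP (g h : treeAut) : g =1 h -> g = h.
Proof.
case: g h => [g g1 g2] [h h1 h2] /= /funext E; subst h.
by congr TreeAut; exact: Prop_irrelevance.
Qed.

HB.instance Definition _ := gen_eqMixin treeAut.
HB.instance Definition _ := gen_choiceMixin treeAut.

Fact treeAut_inv_ex (g : treeAut) : exists f, cancel g f /\ cancel f g.
Proof. by have [f gK fK] := treeAut_bij g; exists f. Qed.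
Definition treeAut_invf (g : treeAut) : seq X -> seq X :=
  projT1 (cid (treeAut_inv_ex g)).
Lemma treeAut_funK (g : treeAut) : cancel g (treeAut_invf g).
Proof. by rewrite /treeAut_invf; case: cid => f []. Qed.
Lemma treeAut_invfK (g : treeAut) : cancel (treeAut_invf g) g.
Proof. by rewrite /treeAut_invf; case: cid => f []. Qed.

Definition treeAut_one : treeAut :=
  @TreeAut id (Bijective (fun=> erefl) (fun=> erefl)) (fun _ _ => erefl).

Fact treeAut_mul_prefix (g h : treeAut) : {mono g \o h : a b / prefix a b}.
Proof. by move=> a b; rewrite /= !treeAut_prefix. Qed.
Definition treeAut_mul (g h : treeAut) : treeAut :=
  TreeAut (bij_comp (treeAut_bij g) (treeAut_bij h)) (treeAut_mul_prefix g h).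

Fact treeAut_inv_prefix (g : treeAut) : {mono treeAut_invf g : a b / prefix a b}.
Proof. by move=> a b; rewrite -(treeAut_prefix g) !treeAut_invfK. Qed.
Definition treeAut_inv (g : treeAut) : treeAut :=
  TreeAut (Bijective (treeAut_invfK g) (treeAut_funK g)) (treeAut_inv_prefix g).

Fact treeAut_mulA : associative treeAut_mul.
Proof. by move=> g h k; apply: treeAutP. Qed.
Fact treeAut_mul1g : left_id treeAut_one treeAut_mul.
Proof. by move=> g; apply: treeAutP. Qed.
Fact treeAut_mulg1 : right_id treeAut_one treeAut_mul.
Proof. by move=> g; apply: treeAutP. Qed.
Fact treeAut_mulVg : left_inverse treeAut_one treeAut_inv treeAut_mul.
Proof. by move=> g; apply: treeAutP => w; exact: treeAut_funK. Qed.
Fact treeAut_mulgV : right_inverse treeAut_one treeAut_inv treeAut_mul.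
Proof. by move=> g; apply: treeAutP => w; exact: treeAut_invfK. Qed.

HB.instance Definition _ := isGroup.Build treeAut
  treeAut_mulA treeAut_mul1g treeAut_mulg1 treeAut_mulVg treeAut_mulgV.

(* [g w] is a prefix of [g (w ++ u)]: see [section_funE]. *)
Definition section_fun (g : treeAut) (w u : seq X) : seq X :=
  drop (size (g w)) (g (w ++ u)).

Lemma section_funE (g : treeAut) w u : g (w ++ u) = g w ++ section_fun g w u.
Proof.
have: prefix (g w) (g (w ++ u)) by rewrite treeAut_prefix prefix_prefix.
by rewrite /section_fun => /prefixP[v ->]; rewrite drop_size_cat.
Qed.

Fact section_bij (g : treeAut) w : bijective (section_fun g w).
Proof.
have cat_inj (s u v : seq X) : s ++ u = s ++ v -> u = v.
  by move/eqP; rewrite eqseq_cat // => /andP[_ /eqP].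
exists (fun v => drop (size w) (treeAut_invf g (g w ++ v))) => [u | v].
  by rewrite -section_funE treeAut_funK drop_size_cat.
have: prefix w (treeAut_invf g (g w ++ v)).
  by rewrite -(treeAut_prefix g) treeAut_invfK prefix_prefix.
case/prefixP=> u E; rewrite E drop_size_cat //.
by apply: (cat_inj (g w)); rewrite -section_funE -E treeAut_invfK.
Qed.

Fact section_prefix (g : treeAut) w : {mono section_fun g w : a b / prefix a b}.
Proof.
have cat_prefix (s u v : seq X) : prefix (s ++ u) (s ++ v) = prefix u v.
  by elim: s => //= x s IHs; rewrite eqxx.
by move=> a b; rewrite -(cat_prefix (g w)) -!section_funE treeAut_prefix.
Qed.

Definition tree_section (g : treeAut) (w : seq X) : treeAut :=
  TreeAut (section_bij g w) (section_prefix g w).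

Lemma tree_sectionE (g : treeAut) w u : g (w ++ u) = g w ++ tree_section g w u.
Proof. exact: section_funE. Qed.

Definition self_similar (G : groupClosed treeAut) : Prop :=
  forall (g : treeAut) (w : seq X), g \in G -> tree_section g w \in G.

Definition finite_state (g : treeAut) : Prop := finite_set (range (tree_section g)).

Definition bounded (g : treeAut) : Prop :=
  exists N : nat, forall n : nat, (1 <= n)%N ->
    (#|[set v : n.-tuple X | tree_section g v != 1%g]| <= N)%N.

Definition bounded_automata_group (G : groupClosed treeAut) : Prop :=
  [/\ finitely_generated G, self_similar G &
      forall g : treeAut, g \in G -> bounded g /\ finite_state g].

Definition basilica_generator (g : treeAut) : Prop :=
  (forall x : X, tree_section g [:: x] = 1) \/
  ((forall x : X, tree_section g [:: x] = 1 \/ tree_section g [:: x] = g) /\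
   exists! x : X, tree_section g [:: x] = g).

Definition generalized_basilica (G : groupClosed treeAut) : Prop :=
  exists Y : set treeAut, [/\ finite_set Y, generates Y G &
    forall g : treeAut, Y g -> basilica_generator g].

End TreeAut.

(* Main.v *)
Require Import Defs.
From HB Require Import structures.
From mathcomp Require Import all_boot all_fingroup.
From mathcomp Require Import boolp classical_sets functions cardinality.

(** A section of [g] at a deep enough level is trivial or repeats itself, and
    this makes it a basilica generator once letters are grouped into blocks.

    In a torsion-free self-similar group a nontrivial element has a nontrivial
    section at every level: if all its sections at level [n] were trivial, it
    would only permute the words of length [n], and have finite order
    ([finitary_torsion], [torsion_free_deep]).  So the number of nontrivial
    sections of [g] at level [n] does not decrease with [n].  It is bounded,
    hence constant from some level on, and beyond that level each nontrivial
    section [q] is _thin_: at each level exactly one section of [q] is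
    nontrivial ([bounded_eventually_thin]).  These form a single sequence
    [q = q_0, q_1, q_2] and so on, where [q_(i + j)] is the nontrivial section
    of [q_i] at level [j].  If [g] is finite state, two of them coincide, and
    the sequence is eventually periodic ([thin_eventually_periodic]).

    As the generators are finitely many, there are a level [k] and a common
    period [m] that suit them all.  Let [L] be generated by the sections of the
    generators at level [k]; it is a subgroup of [G] by self-similarity.
    Reading a word over [X] as a word over [O = X^m] embeds [L] in the
    automorphism group of the tree over [O] ([block_aut]); there each generator [q <> 1] of [L] has exactly one
    nontrivial section at level 1, equal to [q] itself, so the image [H] is a
    generalized basilica group ([block_aut_basilica]).  Finally an element of
    [G] is determined by its action on [X^k] and its sections at level [k],
    which lie in [L] ([level_sections_generated], [wreath_embedding]). *)

Set Implicit Arguments.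
Unset Strict Implicit.
Unset Printing Implicit Defensive.

Local Open Scope group_scope.

(** * Subgroups of a group *)

(** Membership in a [groupClosed] predicate is boolean; classically any subset
    closed under division defines one. *)
Lemma groupClosed_of_prop (gT : groupType) (P : gT -> Prop) :
  P 1 -> (forall x y, P x -> P y -> P (x * y^-1)) ->
  exists S : groupClosed gT, forall x, (x \in S) <-> P x.
Proof.
move=> P1 PF; pose A : {pred gT} := [pred x | `[< P x >]].
have cA : group_closed A.
  split=> [|x y]; first exact/asboolP.
  by move=> /asboolP Px /asboolP Py; apply/asboolP/PF.
pose S : groupClosed gT := HB.pack A
  (isInvClosed.Build _ A (group_closedV cA)) (isMul1Closed.Build _ A cA.1)
  (isMulClosed.Build _ A (group_closedM cA)).
by exists S => x; split=> /asboolP.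
Qed.

Lemma exists_generated (gT : groupType) (Y : set gT) :
  exists L : groupClosed gT, generates Y L.
Proof.
have [|x y Yx Yy K YK|L LP] := @groupClosed_of_prop gT
  (fun x => forall K : groupClosed gT, (Y `<=` [set` K])%classic -> x \in K).
- by move=> K _; apply: gpred1.
- by rewrite gpredF ?Yx ?Yy.
by exists L; split=> [x Yx|K YK x /LP]; [apply/LP => K; apply|apply].
Qed.

Lemma subgroup_torsion_free (gT : groupType) (G : groupClosed gT) :
  torsion_free (subgroup G) <->
  (forall (x : gT) n, x \in G -> (0 < n)%N -> x ^+ n = 1 -> x = 1).
Proof.
split=> [tfG x n xG n0 xn | tfG x n n0 xn].
  have /(congr1 val) // : (exist _ x xG : subgroup G) = 1.
  by apply: (tfG _ n n0); apply: val_inj; rewrite gmulfXn gmulf1.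
apply: val_inj; rewrite gmulf1; apply: (tfG _ n (valP x) n0).
by rewrite -gmulfXn xn gmulf1.
Qed.

(** * Finiteness arguments *)

Lemma finite_range_repeat (T : eqType) (A : set T) (f : nat -> T) :
  finite_set A -> (forall n, A (f n)) -> exists i j, (i < j)%N /\ f i = f j.
Proof.
move=> /finite_seqP[r ->] fr; apply: contrapT => no_repeat.
have f_inj : injective f.
  move=> i j eq_f; case: (ltngtP i j) => // lt_ij; case: no_repeat.
    by exists i, j.
  by exists j, i.
have := uniq_leq_size (s1 := [seq f i | i <- iota 0 (size r).+1]) (s2 := r).
rewrite map_inj_uniq // iota_uniq size_map size_iota ltnn => /(_ isT) ff.
by suff: false by []; apply: ff => _ /mapP[i _ ->]; exact: fr.
Qed.

(** A property that holds for all large [k] and all multiples [m] of some period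
    does so uniformly over a finite family: take the largest threshold and the
    product of the periods. *)
Lemma uniform_threshold (T : eqType) (Q : T -> nat -> nat -> Prop) (s : seq T) :
  (forall x, x \in s -> exists a p, (0 < p)%N /\
     forall k m, (a <= k)%N -> (p %| m)%N -> Q x k m) ->
  exists a p, (0 < p)%N /\
    forall k m, (a <= k)%N -> (p %| m)%N -> forall x, x \in s -> Q x k m.
Proof.
elim: s => [_|y s IHs Qs]; first by exists 0, 1%N.
have [|a [p [p0 Qap]]] := IHs; first by move=> x xs; apply: Qs; rewrite inE xs orbT.
have [|b [q [q0 Qbq]]] := Qs y; first exact: mem_head.
exists (maxn b a), (q * p)%N; split=> [|k m]; first by rewrite muln_gt0 q0.
rewrite geq_max => /andP[bk ak] qpm x; rewrite inE => /predU1P[->|].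
  by apply: Qbq => //; apply: dvdn_trans qpm; apply: dvdn_mulr.
by apply: Qap => //; apply: dvdn_trans qpm; apply: dvdn_mull.
Qed.

(** * Image of a subgroup under an injective homomorphism *)

Section Transport.
Variables (gT hT : groupType) (phi : UMagmaMorphism.type gT hT).
Hypothesis phi_inj : injective phi.

Lemma exists_image (L : groupClosed gT) :
  exists H : groupClosed hT, forall y, (y \in H) <-> exists2 x, x \in L & phi x = y.
Proof.
apply: groupClosed_of_prop => [|_ _ [x xL <-] [y yL <-]].
  by exists 1; rewrite ?gpred1 ?gmulf1.
by exists (x * y^-1); rewrite ?gpredF // gmulfF.
Qed.

Lemma exists_preimage (K : groupClosed hT) :
  exists L : groupClosed gT, forall x, (x \in L) <-> phi x \in K.
Proof.
apply: groupClosed_of_prop => [|x y Kx Ky]; first by rewrite gmulf1 gpred1.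
by rewrite gmulfF gpredF.
Qed.

Variables (L : groupClosed gT) (H : groupClosed hT).
Hypothesis HP : forall y, (y \in H) <-> exists2 x, x \in L & phi x = y.

Lemma image_generates Y : generates Y L -> generates (phi @` Y)%classic H.
Proof.
move=> [YL genL]; split=> [_ [x Yx <-]|K YK y /HP[x xL <-]].
  by apply/HP; exists x => //; apply: YL.
have [L' L'P] := exists_preimage K.
by apply/L'P; apply: genL xL => z Yz; apply/L'P/YK; exists z.
Qed.

Lemma image_torsion_free : torsion_free (subgroup L) -> torsion_free (subgroup H).
Proof.
move=> /subgroup_torsion_free tfL; apply/subgroup_torsion_free => y n /HP[x xL <-].
move=> n0; rewrite -gmulfXn -(gmulf1 (s := phi)) => /phi_inj xn.
by congr (phi _); exact: tfL xn.
Qed.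

Lemma image_isomorphic : isomorphic (subgroup H) (subgroup L).
Proof.
have fH (x : subgroup L) : phi (val x) \in H.
  by apply/HP; exists (val x) => //; exact: valP.
have /choice[f fP] : forall y : subgroup H, exists x : subgroup L, phi (val x) = val y.
  by move=> y; have /HP[x xL E] := valP y; exists (exist _ x xL).
have fM : {morph f : x y / x * y}.
  by move=> x y; apply/val_inj/phi_inj; rewrite fP gmulfM [RHS]gmulfM !fP.
pose F : {multiplicative subgroup H -> subgroup L} :=
  HB.pack f (isMultiplicative.Build _ _ f fM).
exists F; exists (fun x => Sub (phi (val x)) (fH x) : subgroup H) => x.
  by apply: val_inj; rewrite /= fP.
by apply/val_inj/phi_inj; rewrite fP.
Qed.

End Transport.

(** * Sections and levels *)

Section TreeSections.
Variable X : finType.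
Implicit Types (g h : treeAut X) (u v w : seq X).

Lemma tree_inj g : injective g.
Proof. exact: bij_inj (treeAut_bij g). Qed.

Lemma tree_nil g : g [::] = [::].
Proof.
have := treeAut_prefix g [::] (treeAut_invf g [::]).
by rewrite treeAut_invfK prefix0s prefixs0 => /eqP.
Qed.

(** [g] sends a proper prefix to a proper prefix, so it cannot shorten a word,
    and neither can its inverse. *)
Lemma tree_size g w : size (g w) = size w.
Proof.
have le h v : size v <= size (h v).
  elim/last_ind: v => // v x IHv; rewrite size_rcons -cats1 tree_sectionE.
  rewrite size_cat; case E: (tree_section h v [:: x]) => [|y s].
    by have := @tree_inj (tree_section h v) [:: x] [::]; rewrite E tree_nil => /(_ erefl).
  by rewrite /= addnS ltnS (leq_trans IHv) ?leq_addr.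
apply/eqP; rewrite eqn_leq le andbT.
by have := le (treeAut_inv g) (g w); rewrite /= treeAut_funK.
Qed.

Lemma section_eq g w h : (forall u, g (w ++ u) = g w ++ h u) -> tree_section g w = h.
Proof.
move=> E; apply: treeAutP => u; have /eqP := E u.
by rewrite tree_sectionE eqseq_cat // => /andP[_ /eqP].
Qed.

Lemma section1 w : tree_section 1 w = 1 :> treeAut X.
Proof. exact: section_eq. Qed.

Lemma section_cat g u v : tree_section g (u ++ v) = tree_section (tree_section g u) v.
Proof. by apply: section_eq => w; rewrite -catA !tree_sectionE catA. Qed.

Lemma sectionM g h w : tree_section (g * h) w = tree_section g (h w) * tree_section h w.
Proof.
apply: section_eq => u.
by rewrite [LHS](_ : _ = g (h (w ++ u))) // !tree_sectionE.
Qed.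

Lemma sectionV g w : tree_section g^-1 w = (tree_section g (g^-1 w))^-1.
Proof. by apply/esym/mulg1_eq; rewrite -sectionM mulgV section1. Qed.

(** The value at a word determines the values at its prefixes. *)
Lemma tree_eq_cofinal g h :
  (forall w, exists u, g (w ++ u) = h (w ++ u)) -> g = h.
Proof.
move=> E; apply: treeAutP => w; have [u /eqP] := E w.
by rewrite !tree_sectionE eqseq_cat ?tree_size // => /andP[/eqP].
Qed.

Lemma tree_eq_level (x0 : X) n g h :
  (forall v, size v = n -> g v = h v /\ tree_section g v = tree_section h v) ->
  g = h.
Proof.
move=> E; apply: tree_eq_cofinal => w; exists (nseq n x0).
rewrite -(cat_take_drop n (w ++ _)) !tree_sectionE.
have /E[-> ->] // : size (take n (w ++ nseq n x0)) = n.
by rewrite size_takel // size_cat size_nseq leq_addl.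
Qed.

Fact level_size g n (v : n.-tuple X) : size (g v) == n.
Proof. by rewrite tree_size size_tuple. Qed.
Definition level_fun g n (v : n.-tuple X) : n.-tuple X := Tuple (level_size g v).

Fact level_fun_inj g n : injective (@level_fun g n).
Proof. by move=> u v /(congr1 val)/tree_inj/val_inj. Qed.
Definition level_perm g n : {perm n.-tuple X} := perm (@level_fun_inj g n).

Lemma level_permE g n (v : n.-tuple X) : level_perm g n v = g v :> seq X.
Proof. by rewrite permE. Qed.

(** The factors swap because the product of permutations applies the left one
    first. *)
Lemma level_permM g h n : level_perm (g * h) n = level_perm h n * level_perm g n.
Proof. by apply/permP => v; apply: val_inj; rewrite permM /= !level_permE. Qed.

Lemma level_permX g n i : level_perm (g ^+ i) n = level_perm g n ^+ i.
Proof.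
elim: i => [|i IHi]; last by rewrite expgSr expgS level_permM IHi.
by apply/permP => v; rewrite perm1; apply: val_inj; exact: level_permE.
Qed.

(** The power that acts trivially on level [n] also has trivial sections there. *)
Lemma finitary_torsion (x0 : X) g n :
  (forall v, size v = n -> tree_section g v = 1) -> g ^+ #[level_perm g n] = 1.
Proof.
set N := #[_] => g1.
have gN1 i v : size v = n -> tree_section (g ^+ i) v = 1.
  elim: i v => [|i IHi] v sv; first exact: section1.
  by rewrite expgSr sectionM IHi ?tree_size // g1 // mulg1.
have fixN v : size v = n -> (g ^+ N) v = v.
  move=> sv; have := level_permE (g ^+ N) (Tuple (introT eqP sv)).
  by rewrite level_permX expg_order perm1.
by apply: (@tree_eq_level x0 n) => v sv; rewrite fixN // gN1 // section1.
Qed.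

(** * Thin automorphisms *)

Definition thin g : Prop := forall u v, size u = size v ->
  tree_section g u <> 1 -> tree_section g v <> 1 -> u = v.

Lemma section_neq1_prefix g u v : tree_section g (u ++ v) <> 1 -> tree_section g u <> 1.
Proof. by rewrite section_cat => guv gu; apply: guv; rewrite gu section1. Qed.

(** Let [s n] be the word of length [n] at which [g] has a nontrivial section.
    By finiteness [g] has the same section at [s i] and [s j] for some [i < j],
    and the same sections below these two words; the period is [j - i]. *)
Lemma thin_eventually_periodic g : finite_state g -> thin g ->
  (forall n, exists2 v, size v = n & tree_section g v <> 1) ->
  exists a p, (0 < p)%N /\ forall u w, (a <= size u)%N -> size w = p ->
    tree_section g (u ++ w) <> 1 -> tree_section g (u ++ w) = tree_section g u.
Proof.
move=> fin_g tg deep_g.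
have /choice[s sP] : forall n, exists v, size v = n /\ tree_section g v <> 1.
  by move=> n; have [v] := deep_g n; exists v.
have [i [j [lt_ij eq_ij]]] : exists i j, (i < j)%N /\
    tree_section g (s i) = tree_section g (s j).
  by apply: (finite_range_repeat fin_g) => n; exists (s n).
have on_path u v : tree_section g (u ++ v) <> 1 -> u = s (size u).
  by move/section_neq1_prefix => gu; have [ss gs] := sP (size u); apply: tg.
have take_path u : (i <= size u)%N -> tree_section g u <> 1 -> take i u = s i.
  move=> iu; rewrite -{1}(cat_take_drop i u) => /on_path.
  by rewrite size_takel.
exists i, (j - i)%N; split=> [|u w iu sw guw]; first by rewrite subn_gt0.
have gu := section_neq1_prefix guw; have def_u := take_path _ iu gu.
set u' := drop i u; have {}def_u : u = s i ++ u' by rewrite -def_u cat_take_drop.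
have gu' : tree_section g (s j ++ u') = tree_section g u.
  by rewrite def_u !section_cat eq_ij.
(* Both words have length [size u + (j - i)], and thinness leaves only one such
   word with a nontrivial section. *)
have -> : u ++ w = s j ++ u'; last by [].
apply: tg => //; last by rewrite gu'.
rewrite !size_cat sw (sP j).1 /u' size_drop -{1}(subnK iu) -addnA.
by rewrite subnKC 1?ltnW // addnC.
Qed.

(** Only nontrivial sections are compared, so the intermediate sections needed
    to go down [t] periods are nontrivial too. *)
Lemma periodic_multiple g a p : (0 < p)%N ->
  (forall u w, (a <= size u)%N -> size w = p ->
    tree_section g (u ++ w) <> 1 -> tree_section g (u ++ w) = tree_section g u) ->
  forall t u w, (a <= size u)%N -> size w = (t * p)%N ->
    tree_section g (u ++ w) <> 1 -> tree_section g (u ++ w) = tree_section g u.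
Proof.
move=> p0 per; elim=> [|t IHt] u w au sw.
  by rewrite (size0nil sw) cats0.
rewrite -(cat_take_drop p w) catA => nt.
have st : size (take p w) = p by rewrite size_takel // sw mulSn leq_addr.
rewrite IHt //; first by apply: per => //; exact: section_neq1_prefix nt.
  by rewrite size_cat (leq_trans au) // leq_addr.
by rewrite size_drop sw mulSn addKn.
Qed.

Lemma torsion_free_deep (x0 : X) (G : groupClosed (treeAut X)) g :
  torsion_free (subgroup G) -> g \in G -> g <> 1 ->
  forall n, exists2 w, size w = n & tree_section g w <> 1.
Proof.
move=> /subgroup_torsion_free tfG gG g1 n; apply: contrapT => triv; apply: g1.
apply: (tfG _ #[level_perm g n]) => //; apply: (finitary_torsion x0) => v sv.
by apply: contrapT => gv; apply: triv; exists v.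
Qed.

(** Take the level [K] with the most nontrivial sections.  By the second
    hypothesis, truncation maps the words of a deeper level with a nontrivial
    section onto those of level [K]; by the choice of [K] this surjection is
    injective, so that no word of level at least [K] branches. *)
Lemma bounded_eventually_thin g : bounded g ->
  (forall u n, tree_section g u <> 1 ->
     exists2 v, size v = n & tree_section g (u ++ v) <> 1) ->
  exists K, forall v, (K <= size v)%N -> thin (tree_section g v).
Proof.
move=> [N bN] deep_g.
pose A n := [set v : n.-tuple X | tree_section g v != 1]%SET.
pose card_A c := `[< exists2 n, (1 <= n)%N & #|A n| = c >].
have ex_c : exists c, card_A c by exists #|A 1%N|; apply/asboolP; exists 1%N.
have le_c c : card_A c -> (c <= N)%N by move/asboolP=> [n n1 <-]; exact: bN.
case: (ex_maxnP ex_c le_c) => c /asboolP[K K1 cK] c_max.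
exists K => v Kv u1 u2 su g1 g2.
set n := (size v + size u1)%N.
have Kn : (K <= n)%N by rewrite (leq_trans Kv) ?leq_addr.
have st (w : n.-tuple X) : size (take K w) == K by rewrite size_takel ?size_tuple.
pose tr (w : n.-tuple X) : K.-tuple X := Tuple (st w).
(* Truncation is onto: a nontrivial section at level [K] persists below. *)
have sub : A K \subset [set tr w | w in A n]%SET.
  apply/fintype.subsetP => w; rewrite inE => /eqP gw.
  have [w' sw' gww'] := deep_g w (n - K)%N gw.
  have sz : size (w ++ w') == n by rewrite size_cat size_tuple sw' subnKC.
  apply/imsetP; exists (Tuple sz); first by rewrite inE; apply/eqP.
  by apply: val_inj; rewrite /= take_size_cat ?size_tuple.
have /imset_injP tr_inj : #|[set tr w | w in A n]%SET| == #|A n|.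
  rewrite eqn_leq leq_imset_card (leq_trans _ (subset_leq_card sub)) // cK.
  by apply: c_max; apply/asboolP; exists n => //; exact: leq_trans Kn.
have s1 : size (v ++ u1) == n by rewrite size_cat.
have s2 : size (v ++ u2) == n by rewrite size_cat -su.
have /(congr1 val)/= /eqP : Tuple s1 = Tuple s2.
  apply: tr_inj; rewrite ?inE; try by apply/eqP; rewrite section_cat.
  by apply: val_inj; rewrite /= !takel_cat.
by rewrite eqseq_cat // => /andP[_ /eqP].
Qed.

End TreeSections.

(** * Grouping letters into blocks *)

Section Blocks.
(* Blocks have length [p.+1]: the empty block would be lost by [unblock]. *)
Variables (X : finType) (p : nat).
Local Notation O := (p.+1.-tuple X).
Implicit Types (g h : treeAut X) (a b w : seq O).

Definition unblock w : seq X := flatten [seq val x | x <- w].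

Lemma unblock_cat a b : unblock (a ++ b) = unblock a ++ unblock b.
Proof. by rewrite /unblock map_cat flatten_cat. Qed.

Lemma prefix_unblock a b : prefix (unblock a) (unblock b) = prefix a b.
Proof.
elim: a b => [|x a IHa] [|y b] //; first by rewrite !prefix0s.
  by case/tupleP: x => x c.
rewrite -[unblock (x :: a)]/(x ++ unblock a) -[unblock (y :: b)]/(y ++ unblock b).
by rewrite prefix_catr ?size_tuple // IHa.
Qed.

Lemma unblock_inj : injective unblock.
Proof.
move=> a b E; have := prefix_refl (unblock a); rewrite {2}E prefix_unblock.
case/prefixP=> c def_b; move: E; rewrite def_b unblock_cat.
case: c {def_b} => [|x c]; first by rewrite cats0.
move/(congr1 size)/eqP; rewrite /= !size_cat size_tuple -[X in X == _]addn0.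
by rewrite eqn_add2l.
Qed.

Lemma unblock_surj t u : size u = (t * p.+1)%N -> exists w, unblock w = u.
Proof.
elim: t u => [|t IHt] u su; first by exists [::]; rewrite (size0nil su).
have s1 : size (take p.+1 u) == p.+1 by rewrite size_takel // su mulSn leq_addr.
have [|w Ew] := IHt (drop p.+1 u); first by rewrite size_drop su mulSn addKn.
by exists (Tuple s1 :: w); rewrite /unblock /= -/(unblock w) Ew cat_take_drop.
Qed.

Fixpoint block_fun g w : seq O :=
  if w is x :: w' then level_perm g p.+1 x :: block_fun (tree_section g x) w'
  else [::].

Lemma unblock_fun g w : unblock (block_fun g w) = g (unblock w).
Proof.
elim: w g => [|x w IHw] g /=; first by rewrite tree_nil.
by rewrite /unblock /= -!/(unblock _) level_permE IHw tree_sectionE.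
Qed.

Fact block_bij g : bijective (block_fun g).
Proof.
exists (block_fun g^-1) => w; apply: unblock_inj; rewrite !unblock_fun.
  exact: treeAut_funK.
exact: treeAut_invfK.
Qed.

Fact block_prefix g : {mono block_fun g : a b / prefix a b}.
Proof.
by move=> a b; rewrite -prefix_unblock !unblock_fun treeAut_prefix prefix_unblock.
Qed.

Definition block_aut g : treeAut O := TreeAut (block_bij g) (@block_prefix g).

Lemma unblock_aut g w : unblock (block_aut g w) = g (unblock w).
Proof. exact: unblock_fun. Qed.

Lemma block_autM : {morph block_aut : g h / g * h}.
Proof.
move=> g h; apply: treeAutP => w; apply: unblock_inj.
rewrite unblock_aut [in RHS](_ : _ w = block_aut g (block_aut h w)) //.
by rewrite !unblock_aut.
Qed.

Fact block_aut1 : block_aut 1 = 1.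
Proof. by apply: (mulgI (block_aut 1)); rewrite -block_autM !mulg1. Qed.

HB.instance Definition _ :=
  isUMagmaMorphism.Build (treeAut X) (treeAut O) block_aut (block_aut1, block_autM).

Lemma block_aut_section g w :
  tree_section (block_aut g) w = block_aut (tree_section g (unblock w)).
Proof.
apply: section_eq => u; apply: unblock_inj.
by rewrite unblock_cat !unblock_aut unblock_cat tree_sectionE.
Qed.

Lemma block_aut_inj (x0 : X) : injective block_aut.
Proof.
move=> g h E; apply: tree_eq_cofinal => w; exists (nseq (size w * p) x0).
have [|a <-] := @unblock_surj (size w) (w ++ nseq (size w * p) x0).
  by rewrite size_cat size_nseq mulnS.
by rewrite -!unblock_aut E.
Qed.

Lemma block_aut_basilica (x0 : X) g : thin g ->
  (g <> 1 -> exists2 w : seq X, size w = p.+1 & tree_section g w <> 1) ->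
  (forall w : seq X, size w = p.+1 -> tree_section g w <> 1 -> tree_section g w = g) ->
  basilica_generator (block_aut g).
Proof.
have secE (x : O) : tree_section (block_aut g) [:: x] = block_aut (tree_section g x).
  by rewrite block_aut_section /unblock /= cats0.
move=> tg deep per; have [->|g1] := pselect (g = 1).
  by left=> x; rewrite block_aut1 section1.
right; split=> [x|].
  rewrite secE; have [->|gx] := pselect (tree_section g x = 1).
    by left; rewrite block_aut1.
  by right; rewrite per ?size_tuple.
have [w /eqP sw gw] := deep g1; exists (Tuple sw).
have {}per : tree_section g w = g by apply: per => //; exact/eqP.
split=> [|x]; first by rewrite secE /= per.
rewrite secE => /(block_aut_inj x0) gx; apply: val_inj; apply: tg => //=.
- by rewrite size_tuple (eqP sw).
- by rewrite gx.
Qed.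

End Blocks.

(** * Deep sections, and the embedding in the wreath product *)

(** Combines thinness, which starts at a level [K], with the thresholds and
    periods of the finitely many sections at level [K]. *)
Lemma eventually_thin_periodic (X : finType) (x0 : X) (G : groupClosed (treeAut X)) g :
  torsion_free (subgroup G) -> self_similar G -> g \in G ->
  bounded g -> finite_state g ->
  exists a p, (0 < p)%N /\ forall k m, (a <= k)%N -> (p %| m)%N ->
    forall v, size v = k -> thin (tree_section g v) /\
      forall w, size w = m -> tree_section g (v ++ w) <> 1 ->
        tree_section g (v ++ w) = tree_section g v.
Proof.
move=> tfG ssG gG bg fg.
have deep u n : tree_section g u <> 1 ->
    exists2 v, size v = n & tree_section g (u ++ v) <> 1.
  move=> gu; have [v sv gv] := torsion_free_deep x0 tfG (ssG _ u gG) gu n.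
  by exists v; rewrite ?section_cat.
have [K thinK] := bounded_eventually_thin bg deep.
pose Q (u : K.-tuple X) k m := forall v w : seq X, size v = k -> size w = m ->
  tree_section g (u ++ v ++ w) <> 1 ->
  tree_section g (u ++ v ++ w) = tree_section g (u ++ v).
have [|a [p [p0 Qap]]] := @uniform_threshold _ Q (enum {: K.-tuple X}).
  move=> u _; have [gu|gu] := pselect (tree_section g u = 1).
    (* The sections of a trivial section are trivial. *)
    exists 0, 1%N; split=> // k m _ _ v w _ _ guvw; case: guvw.
    by rewrite section_cat gu section1.
  have [||n|a [p [p0 per]]] := @thin_eventually_periodic _ (tree_section g u).
  - apply: sub_finite_set fg => _ [v _ <-]; exists (u ++ v) => //.
    by rewrite section_cat.
  - by apply: thinK; rewrite size_tuple.
  - have [v sv gv] := deep _ n gu.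
    by exists v; rewrite -?section_cat.
  exists a, p; split=> // k m ak /dvdnP[t ->] v w sv sw.
  rewrite !(section_cat g u); apply: (periodic_multiple p0 per) sw.
  by rewrite sv.
exists (K + a)%N, p; split=> // k m ak pm v sv.
have Kv : (K <= size v)%N by rewrite sv (leq_trans _ ak) ?leq_addr.
split=> [|w sw]; first exact: thinK.
have s1 : size (take K v) == K by rewrite size_takel.
have := Qap (k - K)%N m _ pm (Tuple s1) (mem_enum _ _) (drop K v) w _ sw.
rewrite /= catA cat_take_drop; apply; last by rewrite size_drop sv.
by rewrite leq_subRL // (leq_trans _ ak) ?leq_addr.
Qed.

(** Since the section of [g / h] at [v] is that of [g] divided by that of [h],
    both at the preimage of [v] under [h], having all sections at level [k] in
    [L] is a group property. *)
Lemma level_sections_generated (X : finType) k (S : set (treeAut X))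
    (G L : groupClosed (treeAut X)) :
  generates S G ->
  (forall g (v : k.-tuple X), S g -> tree_section g v \in L) ->
  forall g (v : k.-tuple X), g \in G -> tree_section g v \in L.
Proof.
move=> [_ minG] SL.
have [N NP] : exists N : groupClosed (treeAut X), forall g, (g \in N) <->
    (forall v : k.-tuple X, tree_section g v \in L).
  apply: groupClosed_of_prop => [v|g h gL hL v]; first by rewrite section1 gpred1.
  by rewrite sectionM sectionV -level_permE gpredF.
have GN : {subset G <= N} by apply: minG => g Sg; apply/NP => v; exact: SL.
by move=> g v /GN /NP.
Qed.

(** The section of [g h] at [v] is [g_(h v) h_v], which is the multiplication
    rule of the wreath product. *)
Lemma wreath_embedding (X : finType) (x0 : X) (hT : groupType) k
    (phi : UMagmaMorphism.type (treeAut X) hT)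
    (G : groupClosed (treeAut X)) (H : groupClosed hT) :
  injective phi ->
  (forall g (v : k.-tuple X), g \in G -> phi (tree_section g v) \in H) ->
  exists f : {multiplicative subgroup G -> wreath (k.-tuple X) (subgroup H)},
    injective f.
Proof.
move=> phi_inj secH.
pose sec (g : subgroup G) (v : k.-tuple X) : subgroup H :=
  Sub (phi (tree_section (val g) v)) (secH _ v (valP g)).
pose f g := Wreath (level_perm (val g) k) [ffun v => sec g v].
have fM : {morph f : g h / g * h}.
  move=> g h; congr Wreath; first exact: level_permM.
  apply/ffunP=> v; rewrite !ffunE; apply: val_inj.
  by rewrite [RHS]gmulfM /= level_permE -gmulfM -sectionM.
pose F : {multiplicative subgroup G -> wreath (k.-tuple X) (subgroup H)} :=
  HB.pack f (isMultiplicative.Build _ _ f fM).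
exists F => g h [eq_perm eq_sec]; apply: val_inj.
apply: (@tree_eq_level _ x0 k) => v /eqP sv; split.
  have := level_permE (val g) (Tuple sv).
  by rewrite eq_perm level_permE.
move/ffunP/(_ (Tuple sv)): eq_sec; rewrite !ffunE => /(congr1 val).
by rewrite /= => /phi_inj.
Qed.

Theorem proposition1p8 (X : finType) (G : groupClosed (treeAut X)) :
  (2 <= #|X|)%N ->
  torsion_free (subgroup G) ->
  bounded_automata_group G ->
  exists (O : finType) (H : groupClosed (treeAut O)) (k : nat),
    [/\ (2 <= #|O|)%N, torsion_free (subgroup H) & generalized_basilica H] /\
    [/\ (1 <= k)%N,
        isomorphic_to_subgroup (subgroup H) G &
        exists f : {multiplicative subgroup G -> wreath (k.-tuple X) (subgroup H)},
          injective f].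
Proof.
move=> X2 tfG [[S [finS genG]] ssG autG]; have [SG _] := genG.
have /card_gt0P[x0 _] := ltnW X2.
have [s Es] := (finite_seqP _).1 finS.
have sG g : g \in s -> g \in G by move=> gs; apply: SG; rewrite Es.
have [a [p [p0 tp]]] := uniform_threshold (fun g gs =>
  let: conj bg fg := autG g (sG g gs) in
  eventually_thin_periodic x0 tfG ssG (sG g gs) bg fg).
(* Any level from [a] on would do; the successor makes it positive. *)
case: p p0 tp => // p _ tp; pose k := a.+1.
pose Y := [set tree_section g (val v) | g in S & v in [set: k.-tuple X]]%classic.
have finY : finite_set Y by apply: finite_image2.
have [L genL] := exists_generated Y; have [YL L_min] := genL.
have LG : {subset L <= G}.
  by apply: L_min => _ [g Sg [v _ <-]]; apply/ssG/SG.
pose phi : UMagmaMorphism.type _ _ := @block_aut X p.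
have phi_inj : injective phi := block_aut_inj x0.
have [H HP] := exists_image phi L.
have tfL : torsion_free (subgroup L).
  apply/subgroup_torsion_free => x n xL; move/subgroup_torsion_free: tfG; apply.
  exact: LG.
exists (p.+1.-tuple X), H, k; split; split=> //.
- by rewrite card_tuple (leq_trans X2) // expnS leq_pmulr // expn_gt0 ltnW.
- exact: image_torsion_free HP tfL.
- exists (phi @` Y)%classic; split; first exact: finite_image.
    exact: image_generates HP _ genL.
  move=> _ [_ [g Sg [v _ <-]] <-].
  have gs : g \in s by move: Sg; rewrite Es.
  have [thin_v per_v] := tp k p.+1 (leqnSn a) (dvdnn _) g gs v (size_tuple v).
  apply: (block_aut_basilica x0) => // [gv|w sw].
    by have := torsion_free_deep x0 tfG (ssG _ v (sG _ gs)) gv p.+1.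
  by rewrite -section_cat; exact: per_v.
- by exists L; split=> //; exact: image_isomorphic HP.
apply: (wreath_embedding x0 phi_inj) => g v gG; apply/HP.
exists (tree_section g v) => //; apply: level_sections_generated genG _ g v gG.
by move=> h w Sh; apply: YL; exists h => //; exists w.
Qed.
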